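(* Let $\lambda\ge 0$ and $\mu\ge 0$, and let $G$ be a meshed graph satisfying the $(\lambda,\mu)$-bow metric. Then the hyperbolicity $\delta$ of $G$ satisfies $\delta\le 2(\lambda+\mu)+1$, and the slimness $\varsigma$ of $G$ satisfies $\varsigma\le \frac{13}{2}\lambda+5\mu+\frac52$ when $\lambda\le 2(\mu+1)$, and $\varsigma\le 6(\lambda+\mu)+\frac72$ otherwise.
   Context: All graphs are finite, simple, unweighted, undirected and connected, with shortest-path distance $d=d_G$. The interval is $I(u,v)=\{z: d(u,z)+d(z,v)=d(u,v)\}$. A graph satisfies the $(\lambda,\mu)$-bow metric if for all vertices $u,v,w,x$ with $v\in I(u,w)$, $w\in I(v,x)$ and $d(v,w)>\lambda$, one has $d(u,x)\ge d(u,v)+d(v,w)+d(w,x)-\mu$. $G$ is $\delta$-hyperbolic if for any four vertices $u,v,w,x$ the two largest of the sums $d(u,v)+d(w,x)$, $d(u,w)+d(v,x)$, $d(u,x)+d(v,w)$ differ by at most $2\delta$; the hyperbolicity is the least such $\delta$. A geodesic triangle $\Delta(u,v,w)$ is a union of shortest paths $P(u,v),P(v,w),P(w,u)$; it is $\varsigma$-slim if every vertex of each side is at distance at most $\varsigma$ from the union of the other two sides; the slimness of $G$ is the least $\varsigma$ such that all geodesic triangles are $\varsigma$-slim. $G$ is meshed if for any three vertices $u,v,w$ with $d(v,w)=2$ there is a common neighbor $x$ of $v$ and $w$ with $2d(u,x)\le d(u,v)+d(u,w)$. *)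

(* Defs.v *)
From mathcomp Require Import all_boot all_order all_algebra.
From mathcomp Require Import boolp classical_sets reals.

Set Implicit Arguments.
Unset Strict Implicit.
Unset Printing Implicit Defensive.

Import Order.TTheory GRing.Theory Num.Theory.

Local Open Scope ring_scope.

Record sgraph := SGraph {
  vertex :> finType;
  adj : rel vertex;
  adj_sym : symmetric adj;
  adj_irrefl : irreflexive adj }.

Arguments adj {G} : rename.

Section Graph.
Variable G : sgraph.
Implicit Types (u v w x y z : G) (p q r : seq G).

Definition connected_graph := forall x y, connect (@adj G) x y.

Definition walk_of_length (n : nat) x y :=
  [exists p : n.-tuple G, path adj x p && (last x p == y)].

(* The least length of a walk from x to y.  A shortest walk has fewer than
   #|G| edges, hence the bound on the search; the value is #|G| when x and y
   are not connected.  See dist_geodesic and dist_min. *)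
Definition dist x y : nat :=
  find (fun n => walk_of_length n x y) (iota 0 #|G|).

Lemma walk_of_lengthP n x y :
  reflect (exists p, [/\ path adj x p, last x p = y & size p = n])
          (walk_of_length n x y).
Proof.
apply: (iffP existsP) => [[p /andP[xp /eqP py]]|[p [xp py sp]]].
  by exists p; rewrite size_tuple.
have tp : size p == n by apply/eqP.
by exists (Tuple tp); rewrite /= xp py eqxx.
Qed.

Lemma dist_min x p : path adj x p -> (dist x (last x p) <= size p)%N.
Proof.
move=> xp.
case: (shortenP xp) => p' xp' up' pp'.
have sp' : (size p' <= size p)%N by apply: uniq_leq_size => //; case/andP: up'.
apply: leq_trans sp'.
have lt : (size p' < #|G|)%N.
  by have := max_card (mem (x :: p')); rewrite (card_uniqP up').
rewrite leqNgt; apply/negP => /(before_find 0%N).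
rewrite nth_iota // add0n => /walk_of_lengthP[].
by exists p'.
Qed.

Definition geodesic u v p :=
  [/\ path adj u p, last u p = v & size p = dist u v].

Lemma dist_geodesic u v : connect adj u v -> exists p, geodesic u v p.
Proof.
move=> /connectP[p up ->].
have [p' up' Up' _] := shortenP up.
have lt : (size p' < #|G|)%N.
  by have := max_card (mem (u :: p')); rewrite (card_uniqP Up').
have H : has (fun n => walk_of_length n u (last u p')) (iota 0 #|G|).
  apply/hasP; exists (size p'); first by rewrite mem_iota.
  by apply/walk_of_lengthP; exists p'.
have /walk_of_lengthP := nth_find 0%N H.
rewrite nth_iota; last by rewrite -[X in (_ < X)%N](size_iota 0) -has_find.
by rewrite add0n.
Qed.

Definition interval u v : {set G} :=
  [set z | dist u z + dist z v == dist u v]%N.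

Definition meshed :=
  forall u v w, dist v w = 2%N ->
    exists x, [/\ adj v x, adj w x
                & (2 * dist u x <= dist u v + dist u w)%N].

(* In decreasing order. *)
Definition four_point_sums u v w x : seq nat :=
  sort geq [:: dist u v + dist w x;
               dist u w + dist v x;
               dist u x + dist v w]%N.

Variable R : realType.
Implicit Types lambda mu delta sigma : R.

Definition bow_metric lambda mu :=
  forall u v w x, v \in interval u w -> w \in interval v x ->
    lambda < (dist v w)%:R ->
    (dist u x)%:R >= (dist u v)%:R + (dist v w)%:R + (dist w x)%:R - mu.

Definition hyperbolic delta :=
  forall u v w x,
    (nth 0%N (four_point_sums u v w x) 0)%:R
      - (nth 0%N (four_point_sums u v w x) 1)%:R <= 2 * delta.

Definition near_side sigma (A B : seq G) :=
  forall z, z \in A -> exists2 z', z' \in B & (dist z z')%:R <= sigma.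

(* The vertices of the path from u coded by p are those of u :: p. *)
Definition slim sigma :=
  forall u v w p q r,
    geodesic u v p -> geodesic v w q -> geodesic w u r ->
    [/\ near_side sigma (u :: p) ((v :: q) ++ (w :: r)),
        near_side sigma (v :: q) ((u :: p) ++ (w :: r))
      & near_side sigma (w :: r) ((u :: p) ++ (v :: q))].

(* These infima are minima as soon as G has a vertex (and, for slimness, is
   connected): see hyperbolicity_least and slimness_least.  Both are 0 for the
   empty graph. *)
Definition hyperbolicity : R := inf [set delta | hyperbolic delta]%classic.

Definition slimness : R := inf [set sigma | slim sigma]%classic.

Lemma inf_least (P : R -> Prop) m :
  P m -> (forall s, P s -> m <= s) -> inf [set s | P s]%classic = m.
Proof.
move=> Pm mP; apply/le_anti/andP; split.
  by apply: ge_inf => //; exists m => s /mP.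
by apply: lb_le_inf; [exists m | move=> s /mP].
Qed.

Lemma dist_le_card x y : (dist x y <= #|G|)%N.
Proof. by rewrite /dist -{2}(size_iota 0 #|G|) find_size. Qed.

Let half2 (k : nat) : 2 * (k%:R / 2) = k%:R :> R.
Proof. by rewrite mulrC divfK // pnatr_eq0. Qed.

Lemma hyperbolicity_least : G ->
  hyperbolic hyperbolicity
  /\ forall delta, hyperbolic delta -> hyperbolicity <= delta.
Proof.
move=> x0.
have ge0 d : hyperbolic d -> 0 <= 2 * d.
  by move=> /(_ x0 x0 x0 x0); rewrite /four_point_sums /sort /= /geq /= !leqnn /= !leqnn /= subrr.
have Hb : exists k, `[< hyperbolic (k%:R / 2) >].
  exists (#|G| + #|G|)%N; apply/asboolP => u v w x.
  set s := four_point_sums _ _ _ _; rewrite half2 lerBlDr -natrD ler_nat; apply: leq_trans (leq_addr _ _).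
  have [s0|] := ltnP 0 (size s); last by case: (s).
  have := mem_nth 0%N s0; rewrite /s /four_point_sums mem_sort !inE.
  by case/or3P=> /eqP ->; apply: leq_add; apply: dist_le_card.
have [m /asboolP Hm mmin] := ex_minnP Hb.
have mP d : hyperbolic d -> m%:R / 2 <= d.
  move=> Hd; rewrite leNgt; apply/negP; rewrite ltr_pdivlMr // mulrC => dm.
  case: m Hm mmin dm => [|m] _ mmin dm.
    by have := ge0 _ Hd; rewrite leNgt dm.
  suff /asboolP/mmin : hyperbolic (m%:R / 2) by rewrite ltnn.
  move=> u v w x; have := le_lt_trans (Hd u v w x) dm.
  by rewrite half2 lerBlDr ltrBlDr -!natrD ltr_nat ler_nat addSn ltnS.
by rewrite /hyperbolicity (inf_least Hm mP).
Qed.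

Lemma slimness_least : G -> connected_graph ->
  slim slimness /\ forall sigma, slim sigma -> slimness <= sigma.
Proof.
move=> x0 Gc.
have near_nat (s : R) (m : nat) A B :
    s < m.+1%:R -> near_side s A B -> near_side m%:R A B.
  move=> sm sAB z /sAB[z' z'B zs]; exists z' => //.
  by have := le_lt_trans zs sm; rewrite ltr_nat ltnS ler_nat.
have Hb : exists k, `[< slim k%:R >].
  exists #|G|; apply/asboolP => u v w p q r _ _ _.
  have nG A y B : near_side #|G|%:R A (y :: B).
    by move=> z _; exists y; rewrite ?mem_head // ler_nat dist_le_card.
  by split; apply: nG.
have [m /asboolP Hm mmin] := ex_minnP Hb.
have mP s : slim s -> m%:R <= s.
  move=> Hs; rewrite leNgt; apply/negP.
  case: m Hm mmin => [|m] _ mmin sm.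
    have [p p0] := dist_geodesic (Gc x0 x0).
    have [/(_ x0 (mem_head _ _))[z' _ zs] _ _] := Hs _ _ _ _ _ _ p0 p0 p0.
    by have := le_lt_trans zs sm; rewrite ltrn0.
  suff /asboolP/mmin : slim m%:R by rewrite ltnn.
  move=> u v w p q r up vq wr; have [h1 h2 h3] := Hs _ _ _ _ _ _ up vq wr.
  by split; apply: near_nat sm _.
by rewrite /slimness (inf_least Hm mP).
Qed.

End Graph.

Arguments hyperbolicity : clear implicits.
Arguments slimness : clear implicits.

(* Main.v *)
(* A meshed graph has peakless distance functions, so that every triple of
   vertices is joined by a tripod whose centre is an equilateral metric
   triangle.  With L and M the integer parts of lambda and mu, the bow condition
   forces metric triangles to have side at most T = L + M + 1 and intervals to
   be at most k-thin with k = 2 L + M + 1, since larger ones contain two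
   geodesics with overlap L + 1 whose ends are too close.  Comparing the tripods
   of u,v,w and u,x,w along I(u,w) gives four-point defect at most k + T.
   Comparing the sides of a triangle with its tripod, where the farthest a
   vertex can be from the legs is T / 2, gives slimness at most 2 k + T / 2. *)
Require Import Defs.
From mathcomp Require Import all_boot all_order all_algebra.
From mathcomp Require Import boolp classical_sets reals.
From mathcomp Require Import zify lra.

Set Implicit Arguments.
Unset Strict Implicit.
Unset Printing Implicit Defensive.

Import Order.TTheory GRing.Theory Num.Theory.

Local Open Scope ring_scope.

(* [interval] otherwise denotes the MathComp type of order intervals. *)
Local Notation interval := Defs.interval.

(** * Distances and intervals *)

Lemma intervalP (G : sgraph) (u z v : G) :
  reflect (dist u z + dist z v = dist u v)%N (z \in interval u v).
Proof. by rewrite inE; apply: eqP. Qed.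

Lemma dist_refl (G : sgraph) (x : G) : dist x x = 0%N.
Proof. by apply/eqP; rewrite -leqn0; apply: (@dist_min G x [::]). Qed.

Section Metric.
Local Open Scope nat_scope.
Variable G : sgraph.
Hypothesis G_connected : connected_graph G.
Implicit Types u v w x y z : G.

Lemma dist_triangle y x z : dist x z <= dist x y + dist y z.
Proof.
have [p [xp py <-]] := dist_geodesic (G_connected x y).
have [q [yq qz <-]] := dist_geodesic (G_connected y z).
have pq : path adj x (p ++ q) by rewrite cat_path xp py.
by have := dist_min pq; rewrite last_cat py qz size_cat.
Qed.

Lemma dist_eq0 x y : dist x y = 0 -> x = y.
Proof.
have [p [_ <- sp]] := dist_geodesic (G_connected x y).
by rewrite -sp; case: (p).
Qed.

Lemma dist_adj x y : adj x y -> dist x y = 1.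
Proof.
move=> xy; have := @dist_min G x [:: y]; rewrite /= xy => /(_ isT).
case: (posnP (dist x y)) => [/dist_eq0 E|]; last by lia.
by move: xy; rewrite E adj_irrefl.
Qed.

Lemma dist_sym x y : dist x y = dist y x.
Proof.
suff le u v : dist u v <= dist v u by have := le x y; have := le y x; lia.
have [p [vp pu <-]] := dist_geodesic (G_connected v u).
have := @dist_min G (last v p) (rev (belast v p)).
rewrite rev_path (eq_path (e' := adj)); last by move=> ? ?; rewrite adj_sym.
rewrite vp size_rev size_belast => /(_ isT).
suff -> : last (last v p) (rev (belast v p)) = v by rewrite pu.
by case: (p) => [|h s] //=; rewrite rev_cons last_rcons.
Qed.

Ltac metric :=
  intros;
  repeat match goal with
    | H : is_true (_ \in _) |- _ => apply (elimT (intervalP _ _ _)) in H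
    end;
  try apply: (introT (intervalP _ _ _));
  repeat match goal with
    | |- context [dist ?x ?y] => lazymatch goal with
      | _ : dist x y = dist y x |- _ => fail
      | _ : dist y x = dist x y |- _ => fail
      | _ => have := dist_sym x y; intro end
    | _ : context [dist ?x ?y] |- _ => lazymatch goal with
      | _ : dist x y = dist y x |- _ => fail
      | _ : dist y x = dist x y |- _ => fail
      | _ => have := dist_sym x y; intro end
    end;
  lia.

Lemma interval_right u v : v \in interval u v.
Proof. by apply/intervalP; rewrite dist_refl addn0. Qed.

Lemma interval_sym u v z : (z \in interval u v) = (z \in interval v u).
Proof. by apply/idP/idP; metric. Qed.

Lemma interval_trans u v y z :
  y \in interval u v -> z \in interval u y -> z \in interval u v.
Proof.
move=> uyv uzy; have := dist_triangle z u v; have := dist_triangle y z v.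
metric.
Qed.

Lemma interval_trans_mid u v y z :
  y \in interval u v -> z \in interval u y -> y \in interval z v.
Proof.
move=> uyv uzy; have := dist_triangle z u v; have := dist_triangle y z v.
metric.
Qed.

Lemma interval_neighbor x y :
  0 < dist x y -> exists2 h, dist x h = 1 & h \in interval x y.
Proof.
have [[|h p] [/= xp py szp]] := dist_geodesic (G_connected x y).
  by rewrite -szp.
move=> _; have /andP[/dist_adj xh hp] := xp.
exists h => //; have := dist_min hp; rewrite py.
by have := dist_triangle h x y; metric.
Qed.

(** * Peakless distance functions in meshed graphs *)

Section Meshed.
Hypothesis G_meshed : meshed G.

(* Together with [interval_level] this is the local-to-global principle for
   meshed graphs: each function [dist x] is peakless on some geodesic between
   any two vertices. *)
Lemma descent x y z : dist x z < dist x y ->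
  exists h, [/\ dist y h = 1, h \in interval y z & dist x h < dist x y].
Proof.
have [n] := ubnP (dist y z); elim: n y => // n IHn y.
rewrite ltnS => lt_yz lt_xz.
have [|h1 yh1 yh1z] := @interval_neighbor y z.
  by case: posnP lt_xz => // /dist_eq0 ->; rewrite ltnn.
(* Meshedness at y and the next vertex k averages heights. Two uses suffice: a neighbour of height
   at most [dist x y + 1] becomes one of height at most [dist x y], then one below it. *)
have step h : dist y h = 1 -> h \in interval y z -> dist x z < dist x h ->
    exists h', [/\ dist y h' = 1, h' \in interval y z
                 & 2 * dist x h' < dist x y + dist x h].
  move=> yh yhz /IHn[|k [hk hkz lt_k]]; first by metric.
  have yk : dist y k = 2.
    by have := dist_triangle k y z; have := dist_triangle h y k; metric.
  have [h' [/dist_adj yh' /dist_adj kh' le_h']] := G_meshed x yk.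
  exists h'; split=> //; last by lia.
  by have := dist_triangle h' y z; have := dist_triangle k h' z; metric.
have [|le1] := ltnP (dist x h1) (dist x y); first by exists h1.
have [|h2 [yh2 yh2z le2]] := step h1 yh1 yh1z; first by lia.
have [|le2'] := ltnP (dist x h2) (dist x y); first by exists h2.
have tri := dist_triangle y x h1.
have [|h3 [yh3 yh3z le3]] := step h2 yh2 yh2z; first by lia.
by exists h3; split=> //; lia.
Qed.

(** If a first neighbour h rises above both ends, [descent] continues it to some k no higher than y,
    and meshedness at y, k replaces h. *)
Lemma interval_step x y z : 0 < dist y z ->
  exists h, [/\ dist y h = 1, h \in interval y z
              & dist x h <= maxn (dist x y) (dist x z)].
Proof.
move=> /interval_neighbor[h yh yhz]; have tri := dist_triangle y x h.
have [le_h|lt_h] := leqP (dist x h) (maxn (dist x y) (dist x z)).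
  by exists h.
have [|k [hk hkz lt_k]] := @descent x h z; first by lia.
have yk : dist y k = 2.
  by have := dist_triangle k y z; have := dist_triangle h y k; metric.
have [h' [/dist_adj yh' /dist_adj kh' le_h']] := G_meshed x yk.
exists h'; split=> //; last by lia.
by have := dist_triangle h' y z; have := dist_triangle k h' z; metric.
Qed.

Lemma interval_level x y z n : n <= dist y z ->
  exists g, [/\ g \in interval y z, dist y g = n
              & dist x g <= maxn (dist x y) (dist x z)].
Proof.
elim: n => [_|n IHn lt_n].
  by exists y; split; rewrite ?dist_refl ?leq_maxl //; apply/intervalP; rewrite dist_refl.
have [|g [yg dg le_g]] := IHn; first exact: ltnW.
have [|h [gh ghz le_h]] := @interval_step x g z; first by metric.
have := dist_triangle h y z; have := dist_triangle g y h.
by exists h; split; [metric|metric|lia].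
Qed.

(** * Metric triangles and quasi-medians *)

Definition apex y u x :=
  forall h, h \in interval y u -> h \in interval y x -> h = y.

Lemma apex_sym y u x : apex y u x -> apex y x u.
Proof. by move=> A h hu hx; apply: A. Qed.

Lemma apex_sub y u x u' x' : apex y u x ->
  u' \in interval y u -> x' \in interval y x -> apex y u' x'.
Proof. by move=> A yu' yx' h /(interval_trans yu') + /(interval_trans yx'); apply: A. Qed.

(** Otherwise [descent] gives a neighbour of y towards g and closer to x, a second common vertex of
    the two intervals. *)
Lemma apex_dist y u x g :
  apex y u x -> g \in interval y u -> dist x y <= dist x g.
Proof.
move=> A ygu; rewrite leqNgt; apply/negP => /descent[h [yh yhg lt_h]].
suff E : h = y by move: lt_h; rewrite E ltnn.
apply: A; first exact: interval_trans yhg.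
by have := dist_triangle h x y; metric.
Qed.

(** Replacing y by another common vertex of both intervals shortens [dist y u], so this
    terminates. *)
Lemma apex_exists y u x : exists z,
  [/\ z \in interval y u, z \in interval y x & apex z u x].
Proof.
have [n] := ubnP (dist y u); elim: n y => // n IHn y lt_n.
have [[h [yhu yhx /eqP hy]]|H] := pselect (exists h,
    [/\ h \in interval y u, h \in interval y x & h <> y]); last first.
  exists y; split; try by apply/intervalP; rewrite dist_refl.
  by move=> h yhu yhx; apply: contrapT => hy; apply: H; exists h.
have [|z [hzu hzx A]] := IHn h.
  suff : dist y h <> 0 by metric.
  by move=> /dist_eq0 E; rewrite E eqxx in hy.
exists z; split=> //.
  by have := dist_triangle h y z; have := dist_triangle z y u; metric.
by have := dist_triangle h y z; have := dist_triangle z y x; metric.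
Qed.

Definition metric_triangle a b c :=
  [/\ apex a b c, apex b c a & apex c a b].

(** With g another corner, [apex_dist] bounds each side at a corner by the side opposite to that
    corner. *)
Lemma metric_triangle_equilateral a b c : metric_triangle a b c ->
  dist a b = dist b c /\ dist b c = dist c a.
Proof.
move=> [A B C].
have := apex_dist A (interval_right _ _).
have := apex_dist (apex_sym A) (interval_right _ _).
have := apex_dist B (interval_right _ _).
have := apex_dist (apex_sym B) (interval_right _ _).
have := apex_dist C (interval_right _ _).
have := apex_dist (apex_sym C) (interval_right _ _).
metric.
Qed.

Lemma metric_triangle_corner a b c m : metric_triangle a b c ->
  m <= dist b c -> exists r g,
  [/\ r \in interval b a, g \in interval b c
    & [/\ dist b r = m, dist b g = m & dist r g = m]].
Proof.
move=> T le_m; have [A B C] := T.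
have [ab bc] := metric_triangle_equilateral T.
(* The level bound and the apex at b force [dist a g = dist a b], so the r below is equally far from
   b and g; the apexes at b and r make this distance m. *)
have [g [bgc bg le_g]] := interval_level a le_m.
have ge_g := apex_dist B bgc.
have [r [arb arg R]] := apex_exists a b g.
exists r, g; split=> //; first by rewrite interval_sym.
have G' : apex b g r.
  by apply: (apex_sub B) => //; rewrite interval_sym.
have := apex_dist (apex_sym G') (interval_right _ _).
have := apex_dist R (interval_right _ _).
by split=> //; metric.
Qed.

(* The condition [apex y' u x] does not follow from the other ones: it holds
   because y' is chosen first, as far as possible from y. *)
Lemma quasi_median u x y : exists u' x' y',
  [/\ metric_triangle u' x' y', apex y' u x
    & [/\ y' \in interval y u, u' \in interval u y', x' \in interval x u',
          y' \in interval y x & u' \in interval u x /\ x' \in interval x y']].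
Proof.
have [y' [yu yx Y]] := apex_exists y u x.
have [u' [uy ux U]] := apex_exists u y' x.
have [x' [xu xy X]] := apex_exists x u' y'.
have u'x'x : x' \in interval u' x by rewrite interval_sym.
have y'u'u : u' \in interval y' u by rewrite interval_sym.
have y'x'x : x' \in interval y' x by rewrite interval_sym.
have U' := apex_sym (apex_sub U (interval_right _ _) u'x'x).
have Y' := apex_sub Y y'u'u y'x'x.
by exists u', x', y'; split; [split=> //; exact: (apex_sym X)|..].
Qed.

(** * Small triangles and thin intervals from the bow condition *)

Section Bow.
Variables L M : nat.
Hypothesis G_bow : forall u v w x,
  v \in interval u w -> w \in interval v x -> L < dist v w ->
  dist u v + dist v w + dist w x <= dist u x + M.

(* In a larger triangle, the corner of side L + 1 at b cut off by r and g
   extends to the geodesics a-r-g and r-g-c, which overlap in r-g. *)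
Lemma metric_triangle_small a b c :
  metric_triangle a b c -> dist a b <= L + M + 1.
Proof.
move=> T; rewrite leqNgt; apply/negP => lt.
have [ab bc] := metric_triangle_equilateral T; have [A B C] := T.
have [|r [g [rba gbc [br bg rg]]]] := @metric_triangle_corner a b c L.+1 T.
  by lia.
have ag := apex_dist B gbc; have rc := apex_dist (apex_sym B) rba.
have tri1 := dist_triangle r a g; have tri2 := dist_triangle g r c.
have arg : r \in interval a g by metric.
have rgc : g \in interval r c by metric.
by have := G_bow arg rgc; rewrite rg; metric.
Qed.

(** Let t be the side of the quasi-median and s = [dist x x'], which equals [dist y y']. Then
    [dist x y] is 2 s + t, and the cases are s > L, s + t <= L, and the rest. *)
Lemma interval_thin u v x y : x \in interval u v -> y \in interval u v ->
  dist u x = dist u y -> dist x y <= 2 * L + M + 1.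
Proof.
move=> uxv uyv uxy.
have [u' [x' [y' [T Y [yu uy xu yx [ux xy]]]]]] := quasi_median u x y.
have small := metric_triangle_small T.
have [T1 T2] := metric_triangle_equilateral T.
have xx'y : x' \in interval x y.
  by apply: interval_trans xy; rewrite interval_sym.
have u'x'x : x' \in interval u' x by rewrite interval_sym.
have below r : r \in interval u' x' -> r \in interval u x /\ x \in interval v r.
  move=> /(interval_trans u'x'x) ru'x.
  have rux : r \in interval u x.
    rewrite interval_sym; apply: (@interval_trans x u u').
      by rewrite interval_sym.
    by rewrite interval_sym.
  split=> //; rewrite interval_sym.
  exact: interval_trans_mid uxv rux.
have [_ vxx'] := below x' (interval_right _ _).
have [lt_s|le_s] := ltnP L (dist x x').
  (* The geodesics v-x-x' and x-x'-y overlap in more than L, so [dist x y <= M]. *)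
  by have := @G_bow v x x' y vxx' xx'y lt_s; metric.
have [le_st|lt_st] := leqP (dist x x' + dist u' x') L; first by metric.
(* This m makes dist x r = L + 1 below. *)
pose m := dist u' x' + dist x x' - L.+1.
have T' : metric_triangle x' u' y' by case: T => ? ? ?; split; apply: apex_sym.
have [|r [g [ru' gu' [u'r u'g rg]]]] := @metric_triangle_corner x' u' y' m T'.
  by rewrite /m; metric.
have [rux vxr] := below r ru'.
have rx'x := interval_trans_mid u'x'x ru'.
(* Since g is at least as far from x as y', x-r-g is geodesic and overlaps v-x-r in L + 1. Comparing
   with the detour v-y-y'-g bounds s + t by L + M + 1, while s <= L. *)
have xg : dist x y' <= dist x g.
  apply: (apex_dist Y); apply: (@interval_trans _ _ u').
    by rewrite interval_sym.
  by rewrite interval_sym.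
have xrg : r \in interval x g by have := dist_triangle r x g; metric.
have lt_xr : L < dist x r by metric.
have := G_bow vxr xrg lt_xr.
have := dist_triangle y' v g; have := dist_triangle y v y'.
metric.
Qed.

Lemma interval_near u v x y : x \in interval u v -> y \in interval u v ->
  dist u x <= dist u y -> dist x y + dist u x <= dist u y + (2 * L + M + 1).
Proof.
move=> uxv uyv le_xy.
have [z [uzy uz _]] := interval_level u le_xy.
have xz := interval_thin uxv (interval_trans uyv uzy) (esym uz).
by have := dist_triangle z x y; metric.
Qed.

(** * Tripods, the four-point condition and slimness *)

Lemma near_tripod u x y : exists u' x' y' t,
  [/\ t <= L + M + 1, [/\ dist u' x' = t, dist x' y' = t & dist y' u' = t],
      [/\ dist u x = dist u u' + t + dist x x',
          dist x y = dist x x' + t + dist y y'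
        & dist u y = dist u u' + t + dist y y']
    & [/\ u' \in interval u x, u' \in interval u y,
          x' \in interval x u, x' \in interval x y
        & y' \in interval y u /\ y' \in interval y x]].
Proof.
have [u' [x' [y' [T _ [yu uy xu yx [ux xy]]]]]] := quasi_median u x y.
have [e1 e2] := metric_triangle_equilateral T.
exists u', x', y', (dist u' x'); split.
- exact: metric_triangle_small T.
- by split; lia.
- by clear G_bow T; split; metric.
have uyu' : u' \in interval u y.
  by apply: interval_trans uy; rewrite interval_sym.
have xux' : x' \in interval x u.
  by apply: interval_trans xu; rewrite interval_sym.
have xyx' : x' \in interval x y.
  by apply: interval_trans xy; rewrite interval_sym.
by [].
Qed.

(** Let k = 2 L + M + 1. The feet u1, u2 of the two tripods lie in I(u,w), at distance at most k
    plus their difference in level. If u1 is no farther from u than u2, the route v-u1-u2-x gives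
    excess at most t1 + k over [dist u x + dist v w]; otherwise at most t2 + k over
    [dist u v + dist w x]. *)
Lemma four_point u v w x : dist u w + dist v x <=
  maxn (dist u v + dist w x) (dist u x + dist v w) + (3 * L + 2 * M + 2).
Proof.
have [v1 [u1 [w1 [t1 [le1 [vu1 uw1 wv1] [vu uw vw]]]]]] := near_tripod v u w.
move=> [_ _ _ u1w [_ w1u]].
have [x2 [u2 [w2 [t2 [le2 [xu2 uw2 wx2] [xu uw' xw]]]]]] := near_tripod x u w.
move=> [_ _ _ u2w [_ w2u]].
have near_u := interval_near u1w u2w; have near_u' := interval_near u2w u1w.
have near_w := interval_near w1u w2u; have near_w' := interval_near w2u w1u.
have via_u : dist v x <= dist v v1 + t1 + dist u1 u2 + t2 + dist x x2.
  have := dist_triangle v1 v x; have := dist_triangle u1 v1 x.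
  have := dist_triangle u2 u1 x; have := dist_triangle x2 u2 x.
  by rewrite -xu2 -vu1 (dist_sym x2 x) (dist_sym x2 u2); lia.
have via_w : dist v x <= dist v v1 + t1 + dist w1 w2 + t2 + dist x x2.
  have := dist_triangle v1 v x; have := dist_triangle w1 v1 x.
  have := dist_triangle w2 w1 x; have := dist_triangle x2 w2 x.
  by rewrite -wx2 -wv1 (dist_sym x2 x) (dist_sym w1 v1); lia.
move: near_u near_u' near_w near_w'.
rewrite (dist_sym u v) (dist_sym w x) (dist_sym u x) (dist_sym u2 u1) (dist_sym w2 w1).
by lia.
Qed.

(** All that slimness uses about a side, whichever geodesic it is. *)
Definition meets_levels (A : {pred G}) u w := forall n, n <= dist u w ->
  exists2 a, a \in A & a \in interval u w /\ dist u a = n.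

Lemma meets_levels_sym A u w : meets_levels A u w -> meets_levels A w u.
Proof.
move=> H n le_n; have [|a aA [uaw ua]] := H (dist u w - n); first by lia.
by exists a => //; split; metric.
Qed.

(** Go from z to y in I(u,u'), at most t / 2 levels nearer to u, then to a on the level of y. With k
    = 2 L + M + 1 this costs k + t / 2 and k; doubling keeps the bound in [nat]. *)
Lemma near_side_half u v w u' z t (A : {pred G}) :
  t <= L + M + 1 -> u' \in interval u v -> u' \in interval u w ->
  z \in interval u v -> 2 * dist u z <= 2 * dist u u' + t ->
  meets_levels A u w ->
  exists2 a, a \in A & 2 * dist z a <= 9 * L + 5 * M + 5.
Proof.
move=> le_t uu'v uu'w uzv le_z Auw.
have [y [uyu' uy _]] := interval_level u (geq_minr (dist u z) (dist u u')).
have uyv := interval_trans uu'v uyu'; have uyw := interval_trans uu'w uyu'.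
have [|a aA [uaw ua]] := Auw (dist u y).
  by have := elimT (intervalP _ _ _) uyw; lia.
have := interval_thin uyw uaw (esym ua).
have := interval_near uyv uzv; rewrite uy geq_minl => /(_ isT).
have := dist_triangle y z a; rewrite (dist_sym z y).
by exists a => //; lia.
Qed.

Lemma near_sides u v w z (A B : {pred G}) : z \in interval u v ->
  meets_levels A u w -> meets_levels B v w ->
  exists2 z', (z' \in A) || (z' \in B) & 2 * dist z z' <= 9 * L + 5 * M + 5.
Proof.
move=> uzv Auw Bvw.
have [u' [v' [w' [t [le_t _ [uvE _ _]]]]]] := near_tripod u v w.
move=> [uu'v uu'w vv'u vv'w _].
(* Past the midpoint of the middle stretch of length t, the roles of u and v are exchanged. *)
have [le_z|lt_z] := leqP (2 * dist u z) (2 * dist u u' + t).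
  have [a aA le_a] := near_side_half le_t uu'v uu'w uzv le_z Auw.
  by exists a; rewrite ?aA.
have vzu : z \in interval v u by rewrite interval_sym.
have [|b bB le_b] := near_side_half le_t vv'u vv'w vzu _ Bvw.
  by have := elimT (intervalP _ _ _) uzv; rewrite (dist_sym v z); lia.
by exists b; rewrite ?bB ?orbT.
Qed.

End Bow.

End Meshed.

(** * Geodesic paths as sides of triangles *)

Lemma geodesic_take u v p n : geodesic u v p -> n <= dist u v ->
  last u (take n p) \in interval u v /\ dist u (last u (take n p)) = n.
Proof.
move=> [up pv szp] le_n; move: (up) (pv).
rewrite -{1 2}(cat_take_drop n p) cat_path last_cat.
move=> /andP[/dist_min le1 /dist_min le2] E.
move: le1 le2; rewrite E size_takel ?szp // size_drop szp.
by have := dist_triangle (last u (take n p)) u v; split; metric.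
Qed.

Lemma geodesic_mem u v p z : geodesic u v p -> z \in u :: p -> z \in interval u v.
Proof.
move=> [up pv szp] /splitPl E; case: E up pv szp => p1 p2 pz.
rewrite cat_path last_cat size_cat pz => /andP[/dist_min + /dist_min].
rewrite pz => + + E; rewrite E => le1 le2.
by have := dist_triangle z u v; metric.
Qed.

Lemma geodesic_meets_levels u v p :
  geodesic u v p -> meets_levels (mem (u :: p)) u v.
Proof.
move=> up n /(geodesic_take up) H; exists (last u (take n p)) => //.
have := mem_last u (take n p); rewrite !inE => /orP[->//|/mem_take ->].
by rewrite orbT.
Qed.

End Metric.

(** * From integer bounds to the real constants *)

Section Real.
Variables (R : realType) (G : sgraph).
Hypothesis G_connected : connected_graph G.
Implicit Types lambda mu sigma delta : R.

(** Distances are integers, so the strict threshold and the defect can both be rounded down. *)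
Lemma bow_metric_truncn lambda mu (u v w x : G) : 0 <= lambda -> 0 <= mu ->
  bow_metric G lambda mu ->
  v \in interval u w -> w \in interval v x -> (Num.truncn lambda < dist v w)%N ->
  (dist u v + dist v w + dist w x <= dist u x + Num.truncn mu)%N.
Proof.
move=> lambda_ge0 mu_ge0 bow uvw vwx; rewrite truncn_lt_nat // => lt.
have bow_uvwx := bow _ _ _ _ uvw vwx lt.
have /andP[_ lt_mu] := truncn_itv mu_ge0.
suff : (dist u v + dist v w + dist w x)%:R
    < (dist u x + (Num.truncn mu).+1)%:R :> R by rewrite ltr_nat addnS ltnS.
rewrite !natrD; lra.
Qed.

(** By convention [inf] is 0 when no infimum exists, as for the empty graph, where every real is
    admissible; hence [0 <= m]. *)
Lemma inf_le_ge0 (P : R -> Prop) m :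
  0 <= m -> P m -> inf [set s | P s]%classic <= m.
Proof.
move=> m_ge0 Pm; have [Pinf|Pinf] := pselect (has_inf [set s | P s]%classic).
  by apply: ge_inf => //; case: Pinf.
by rewrite inf_out.
Qed.

Lemma hyperbolic_four_point (D : nat) delta :
  (forall u v w x : G, dist u w + dist v x <=
     maxn (dist u v + dist w x) (dist u x + dist v w) + D)%N ->
  D%:R <= 2 * delta -> hyperbolic G delta.
Proof.
move=> H le_D u v w x; apply: le_trans le_D; rewrite lerBlDr -natrD ler_nat.
(* Each of the three sums in turn takes the place of the bounded one. *)
have := H u v w x; have := H u w v x; have := H u v x w.
rewrite /four_point_sums (dist_sym G_connected w v) (dist_sym G_connected x w).
move: (dist u v + dist w x)%N (dist u w + dist v x)%N (dist u x + dist v w)%N.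
move=> a b c; rewrite /sort /= /geq /=.
case: (leqP b a) => ?; case: (leqP c a) => ?; case: (leqP c b) => ? /=.
all: rewrite ?(leqNgt c b) ?(leqNgt c a) /=.
all: repeat (case: leqP => ? /=); lia.
Qed.

Lemma slim_near_sides (N : nat) sigma :
  (forall (u v w z : G) (A B : {pred G}), z \in interval u v ->
     meets_levels A u w -> meets_levels B v w ->
     exists2 z', (z' \in A) || (z' \in B) & (2 * dist z z' <= N)%N) ->
  N%:R <= 2 * sigma -> slim G sigma.
Proof.
move=> H le_N u v w p q r up vq wr.
have near u0 v0 w0 (A B C : seq G) :
    (forall z, z \in C -> z \in interval u0 v0) ->
    meets_levels (mem A) u0 w0 -> meets_levels (mem B) v0 w0 ->
    near_side sigma C (A ++ B) /\ near_side sigma C (B ++ A).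
  move=> HC HA HB; split=> z /HC zI; have [z' z'AB le_z'] := H _ _ _ _ _ _ zI HA HB.
    exists z'; rewrite ?mem_cat //; move: le_z'; rewrite -(ler_nat R) natrM; lra.
  exists z'; rewrite ?mem_cat 1?orbC //; move: le_z'; rewrite -(ler_nat R) natrM; lra.
have levels (x y : G) s (xy : geodesic x y s) : meets_levels (mem (x :: s)) x y
    /\ meets_levels (mem (x :: s)) y x.
  have := geodesic_meets_levels G_connected xy.
  by split=> //; apply: meets_levels_sym.
have [p1 p2] := levels _ _ _ up; have [q1 q2] := levels _ _ _ vq.
have [r1 r2] := levels _ _ _ wr.
split.
- by have [] := near u v w _ _ _ (fun z => geodesic_mem G_connected up) r2 q1.
- by have [] := near v w u _ _ _ (fun z => geodesic_mem G_connected vq) p2 r1.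
- by have [] := near w u v _ _ _ (fun z => geodesic_mem G_connected wr) q2 p1.
Qed.

End Real.

Theorem theorem4 (R : realType) (G : sgraph) (lambda mu : R)
    (G_connected : connected_graph G)
    (lambda_ge0 : 0 <= lambda) (mu_ge0 : 0 <= mu)
    (G_meshed : meshed G) (G_bow : bow_metric G lambda mu) :
  hyperbolicity G R <= 2 * (lambda + mu) + 1
  /\ (lambda <= 2 * (mu + 1) ->
        slimness G R <= 13 / 2 * lambda + 5 * mu + 5 / 2)
  /\ (~ (lambda <= 2 * (mu + 1)) ->
        slimness G R <= 6 * (lambda + mu) + 7 / 2).
Proof.
pose L := Num.truncn lambda; pose M := Num.truncn mu.
have bow u v w x := @bow_metric_truncn R G lambda mu u v w x lambda_ge0 mu_ge0 G_bow.
have le_L : L%:R <= lambda by rewrite truncn_le.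
have le_M : M%:R <= mu by rewrite truncn_le.
rewrite -/L -/M in bow; move: L M bow le_L le_M => L M bow le_L le_M.
(* Half of 9 lambda + 5 mu + 5 lies below both required bounds. *)
have slim_le (s : R) : 0 <= s -> 9 * lambda + 5 * mu + 5 <= 2 * s -> slimness G R <= s.
  move=> s_ge0 le_s; apply: inf_le_ge0 => //.
  apply: (slim_near_sides G_connected (near_sides G_connected G_meshed bow)).
  lra.
split; last by split=> _; apply: slim_le; lra.
apply: inf_le_ge0; first by lra.
(* The defect 3 L + 2 M + 2 is at most 4 (lambda + mu) + 2, twice the bound. *)
apply: (hyperbolic_four_point G_connected (four_point G_connected G_meshed bow)).
lra.
Qed.
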